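(* Let $n>0$. If $t\mapsto(\tau,r,\theta,\varphi)$ is a geodesic of the self-dual Taub-NUT metric (in the region $r>n$) along which $\varphi$ is constant, then $\tau$ is constant along it or $\theta$ is constant along it.
   Context: The self-dual Taub-NUT metric with parameter $n>0$ is $$ds^2=\frac{r-n}{r+n}(d\tau+2n\cos\theta\, d\varphi)^2+(r^2-n^2)(d\theta^2+\sin^2\theta\, d\varphi^2)+\frac{r+n}{r-n}dr^2,$$ in coordinates $(\tau,r,\theta,\varphi)$ with $r>n$, $\theta\in(0,\pi)$. Geodesics are solutions, on an interval, of the geodesic equations of this metric in the parameter $t$ (affinely parametrized curves, possibly constant), considered within this coordinate chart. *)

(* Defs.v *)
From HB Require Import structures.
From mathcomp Require Import all_boot all_order all_algebra.
From mathcomp Require Import all_classical all_reals all_analysis.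

Set Implicit Arguments.
Unset Strict Implicit.
Unset Printing Implicit Defensive.

Import Order.TTheory GRing.Theory Num.Theory.
Import numFieldNormedType.Exports.

Local Open Scope classical_set_scope.
Local Open Scope ring_scope.

(* A metric on a chart of R^m is given by its matrix g x of components
   g_ij(x); the value of g outside the chart is irrelevant. *)

Definition partial (R : realType) (m : nat) (i : 'I_m) (f : 'rV[R]_m -> R)
  (x : 'rV[R]_m) : R := 'D_(delta_mx 0 i) f x.

(* Gamma^k_ij = 1/2 g^kl (d_i g_lj + d_j g_li - d_l g_ij). *)
Definition christoffel (R : realType) (m : nat) (g : 'rV[R]_m -> 'M[R]_m)
  (x : 'rV[R]_m) (k i j : 'I_m) : R :=
  2^-1 * \sum_l invmx (g x) k l *
    (partial i (fun y => g y l j) x + partial j (fun y => g y l i) x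
     - partial l (fun y => g y i j) x).

(* v is the derivative of x relative to J: two-sided at interior points of J,
   one-sided at an endpoint belonging to J. *)
Definition derivative_on (R : realType) (m : nat) (J : set R)
  (x v : R -> 'rV[R]_m) : Prop :=
  forall t, J t -> (s - t)^-1 *: (x s - x t) @[s --> within J t^'] --> v t.

(* x'' ^k + Gamma^k_ij x'^i x'^j = 0 on J, the curve staying in the chart U. *)
Definition geodesic_on (R : realType) (m : nat) (g : 'rV[R]_m -> 'M[R]_m)
  (U : set 'rV[R]_m) (J : set R) (x : R -> 'rV[R]_m) : Prop :=
  (forall t, J t -> U (x t)) /\
  exists v a : R -> 'rV[R]_m,
    [/\ derivative_on J x v, derivative_on J v a &
        forall t, J t -> forall k : 'I_m,
          a t 0 k + \sum_i \sum_j christoffel g (x t) k i j * v t 0 i * v t 0 j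
          = 0].

Definition constant_on (R : realType) (J : set R) (f : R -> R) : Prop :=
  forall s t, J s -> J t -> f s = f t.

(* Coordinates are ordered (tau, r, theta, phi); tau and phi are taken as
   real-valued coordinates, not modulo their periods. *)
Definition i_tau : 'I_4 := @Ordinal 4 0 isT.
Definition i_r : 'I_4 := @Ordinal 4 1 isT.
Definition i_theta : 'I_4 := @Ordinal 4 2 isT.
Definition i_phi : 'I_4 := @Ordinal 4 3 isT.

Definition taub_nut_chart (R : realType) (n : R) : set 'rV[R]_4 :=
  [set x | n < x 0 i_r /\ 0 < x 0 i_theta < pi].

(* The coordinate covector dx^i, and the square w (x) w of a covector w as the
   matrix of a bilinear form. *)
Definition dcoord (R : realType) (i : 'I_4) : 'rV[R]_4 := delta_mx 0 i.
Definition form_sq (R : realType) (w : 'rV[R]_4) : 'M[R]_4 := w^T *m w.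

Definition taub_nut_metric (R : realType) (n : R) (x : 'rV[R]_4) : 'M[R]_4 :=
  let r := x 0 i_r in
  let theta := x 0 i_theta in
  ((r - n) / (r + n)) *:
    form_sq (dcoord R i_tau + (2 * n * cos theta) *: dcoord R i_phi)
  + (r ^+ 2 - n ^+ 2) *:
    (form_sq (dcoord R i_theta) + (sin theta ^+ 2) *: form_sq (dcoord R i_phi))
  + ((r + n) / (r - n)) *: form_sq (dcoord R i_r).

(* Main.v *)
Require Import Defs.
From mathcomp Require Import all_boot all_order all_algebra.
From mathcomp Require Import all_classical all_reals all_analysis.
From mathcomp Require Import ring lra.

Import Order.TTheory GRing.Theory Num.Theory.
Import numFieldNormedType.Exports.

Local Open Scope classical_set_scope.
Local Open Scope ring_scope.

(** The metric depends on neither tau nor phi, so by Noether's theorem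
    ([momentum_constant]) a geodesic carries the two constants
    p_tau = f (tau' + 2 n cos theta phi') and
    p_phi = 2 n cos theta p_tau + (r^2 - n^2) sin^2 theta phi',
    where f = (r - n) / (r + n) > 0.  When phi is constant these become
    p_tau = f tau' and p_phi = 2 n cos theta p_tau.  If p_tau = 0, then
    tau' = 0 everywhere and tau is constant; if p_tau is not 0, dividing the
    two constants shows that cos theta is constant, hence so is theta, since
    cos is injective on [0, pi].

    Noether's theorem is read off from the geodesic equations: lowering the
    index of a Christoffel symbol ([christoffel_lower]) leaves only first
    derivatives of the metric, and for a cyclic coordinate x^k they add up to
    the derivative of p_k = sum_j g_kj x'^j.  This needs the metric to be
    invertible and differentiable ([taub_nut_unit],
    [taub_nut_differentiable]).  Since the time interval may contain its
    endpoints, all derivatives of the curve are taken within it, and a function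
    whose derivative within an interval vanishes is constant there
    ([derives_within0_constant]). *)

(** * Derivatives of scalar functions within an interval *)

(** The scalar counterpart of [derivative_on], at a single point. *)
Definition derives_within {R : realType} (J : set R) (f : R -> R) (t d : R)
  : Prop := (s - t)^-1 * (f s - f t) @[s --> within J t^'] --> d.

Lemma near_within_dnbhs_neq {R : realType} (J : set R) (t : R) :
  \forall s \near within J t^', s != t.
Proof.
have near_neq : \forall s \near t^', s != t by exact: nbhs_dnbhs_neq.
by apply: cvg_within near_neq.
Qed.

Lemma cvg_within_dnbhs_ext {R : realType} {J : set R} {f : R -> R} (g : R -> R)
  {t l : R} :
  (forall s, s != t -> g s = f s) ->
  g s @[s --> within J t^'] --> l -> f s @[s --> within J t^'] --> l.
Proof.
move=> gf gl; apply: cvg_trans gl; apply: near_eq_cvg; near=> s.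
apply: gf; near: s; exact: near_within_dnbhs_neq.
Unshelve. all: by end_near. Qed.

Lemma cvg_sub_within_dnbhs {R : realType} (J : set R) (t : R) :
  (s - t) @[s --> within J t^'] --> 0.
Proof.
rewrite -[X in _ --> X](subrr t); apply: cvgB; last exact: cvg_cst.
by apply: cvg_trans; [exact: cvg_within|exact: cvg_within].
Qed.

Lemma derives_within_coord {R : realType} {m : nat} {J : set R}
  {x v : R -> 'rV[R]_m} {t : R} (i : 'I_m) :
  derivative_on J x v -> J t ->
  derives_within J (fun s => x s 0 i) t (v t 0 i).
Proof.
move=> xv Jt.
have := cvg_comp _ _ (xv t Jt) (@coord_continuous R _ _ 0 i (v t)).
by apply: cvg_within_dnbhs_ext => s _ /=; rewrite !mxE.
Qed.

Lemma derives_within_cvg {R : realType} {J : set R} {f : R -> R} {t d : R} :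
  derives_within J f t d -> f s @[s --> within J t^'] --> f t.
Proof.
move=> fd; rewrite -[X in _ --> X]add0r -[X in _ --> X + _](mul0r d).
apply: cvg_within_dnbhs_ext; last first.
  by apply: cvgD; [apply: cvgM fd; exact: cvg_sub_within_dnbhs|exact: cvg_cst].
by move=> s st /=; rewrite mulrA divff ?mul1r ?subrK// subr_eq0.
Qed.

Lemma derives_withinM {R : realType} {J : set R} {f g : R -> R}
  {t df dg : R} :
  derives_within J f t df -> derives_within J g t dg ->
  derives_within J (fun s => f s * g s) t (df * g t + f t * dg).
Proof.
move=> fd gd; apply: cvg_within_dnbhs_ext; last first.
  apply: cvgD; first by apply: cvgM fd (derives_within_cvg gd).
  by apply: cvgM gd; exact: cvg_cst.
by move=> s _ /=; ring.
Qed.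

Lemma derives_within_sum {R : realType} {J : set R} {I : finType}
  {f : I -> R -> R} {t : R} {d : I -> R} :
  (forall i, derives_within J (f i) t (d i)) ->
  derives_within J (fun s => \sum_i f i s) t (\sum_i d i).
Proof.
move=> fd; apply: cvg_within_dnbhs_ext; last first.
  apply: (@cvg_big _ _ +%R 0 xpredT add_continuous _ _ _
    (fun i s => (s - t)^-1 * (f i s - f i t)) d).
  by move=> i _; exact: fd.
by move=> s _; rewrite /= -mulr_sumr -sumrB.
Qed.

(** First-order expansion of h at x t: the slope of h along the curve is the
    differential of h at the slope of x, plus a remainder that tends to 0
    because the slope of x stays bounded. *)
Lemma derives_within_comp {R : realType} {m : nat} {J : set R}
  {x v : R -> 'rV[R]_m} {h : 'rV[R]_m -> R} {t : R} :
  derivative_on J x v -> J t -> differentiable h (x t) ->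
  derives_within J (h \o x) t (\sum_i partial i h (x t) * v t 0 i).
Proof.
move=> xv Jt hd.
have -> : \sum_i partial i h (x t) * v t 0 i = 'd h (x t) (v t).
  rewrite [v t in RHS]row_sum_delta linear_sum; apply: eq_bigr => i _.
  by rewrite linearZ /partial deriveE// mulrC.
pose q s := (s - t)^-1 *: (x s - x t).
have qv : q s @[s --> within J t^'] --> v t by exact: xv.
pose e k := h (k + x t) - (h (x t) + 'd h (x t) k).
have e_small c : 0 < c ->
    \forall k \near nbhs (0 : 'rV[R]_m), `|e k| <= c * `|k|.
  by move/eqaddoP: (diff_locally hd); exact.
have e0 : (s - t)^-1 * e (x s - x t) @[s --> within J t^'] --> 0.
  apply/cvgr0Pnorm_le => eps eps0.
  (* Near t the slope q s has norm at most |v t| + 1. *)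
  have : \forall k \near nbhs (0 : 'rV[R]_m),
      `|e k| <= eps / (`|v t| + 1) * `|k|.
    by apply: e_small; rewrite divr_gt0// ltr_wpDl.
  have x0 : (s - t) *: q s @[s --> within J t^'] --> (0 : 'rV[R]_m).
    rewrite -[X in _ --> X](scale0r (v t)); apply: cvgZ qv.
    exact: cvg_sub_within_dnbhs.
  move=> /x0 e_le.
  have q_le : \forall s \near within J t^', `|q s| <= `|v t| + 1.
    by apply: (cvgr_norm_le _ qv); rewrite ltrDl.
  near=> s.
  have st : s - t != 0.
    by rewrite subr_eq0; near: s; exact: near_within_dnbhs_neq.
  have xq : x s - x t = (s - t) *: q s by rewrite scalerA divff ?scale1r.
  have qs : `|q s| <= `|v t| + 1 by near: s.
  have vt : 0 < `|v t| + 1 by rewrite ltr_wpDl.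
  have : `|e (x s - x t)| <= eps / (`|v t| + 1) * (`|s - t| * `|q s|).
    by rewrite xq -normrZ; near: s.
  rewrite normrM normfV ler_pdivrMl ?normr_gt0// => /le_trans; apply.
  by rewrite mulrCA ler_wpM2l// mulrAC ler_pdivrMr// ler_wpM2l// ltW.
rewrite /derives_within -[X in _ --> X]addr0.
apply: cvg_within_dnbhs_ext; last first.
  apply: cvgD; last exact: e0.
  by apply: (cvg_comp _ _ qv); exact: diff_continuous.
move=> s _.
rewrite /= /e subrK linearZ /= /GRing.scale /=.
by ring.
Unshelve. all: by end_near. Qed.

(** Derivatives within an interval J are unique as soon as J is not a single
    point: every t in J is then an accumulation point of J. *)
Lemma dnbhs_within_proper {R : realType} {J : set R} {t b : R} :
  is_interval J -> J t -> J b -> b != t -> ProperFilter (within J t^').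
Proof.
move=> iJ Jt Jb bt; apply: Build_ProperFilter_ex => /= P.
rewrite /within /= /dnbhs /within /= => /nbhs_ballP[e /= e0 eP].
pose k := Num.min 1 (e / (2 * `|b - t|)).
have bt0 : 0 < `|b - t| by rewrite normr_gt0 subr_eq0.
have k0 : 0 < k by rewrite lt_min ltr01 divr_gt0// mulr_gt0.
have k1 : k <= 1 by rewrite ge_min lexx.
have ke : k * `|b - t| < e.
  have : k <= e / (2 * `|b - t|) by rewrite ge_min lexx orbT.
  rewrite ler_pdivlMr ?mulr_gt0//; lra.
(* Move from t towards b, inside J, by a distance smaller than e. *)
exists (t + k * (b - t)); apply: eP => /=.
- by rewrite /ball /= opprD addrA subrr add0r normrN normrM (gtr0_norm k0).
- rewrite -subr_eq0 addrAC subrr add0r.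
  by rewrite mulf_neq0 ?subr_eq0 ?(gt_eqF k0).
have [tb|tb] := leP t b.
  by apply: (iJ t b) => //; apply/andP; split; nra.
by apply: (iJ b t) => //; apply/andP; split; nra.
Qed.

(** Between two points of J the derivative within J is an ordinary derivative,
    and at these two points one-sided continuity is enough for the mean value
    theorem. *)
Lemma derives_within0_constant {R : realType} {J : set R} {f : R -> R} :
  is_interval J -> (forall t, J t -> derives_within J f t 0) ->
  constant_on J f.
Proof.
move=> iJ fd.
suff lt s t : J s -> J t -> s < t -> f s = f t.
  move=> s t Js Jt; case: (ltgtP s t) => [st|ts|->//]; first exact: lt.
  by apply/esym/lt.
move=> Js Jt st.
have J_st x : s <= x <= t -> J x by move=> xst; exact: (iJ s t).
have der x : s < x < t -> is_derive x 1 f 0.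
  move=> xst.
  have Jx : J x by case/andP: xst => sx xt; apply: J_st; rewrite !ltW.
  have slope0 : h^-1 *: ((f \o shift x) (h *: 1) - f x) @[h --> 0^'] --> 0.
    apply/cvgr0Pnorm_lt => eps eps0.
    have f_lt : \forall y \near x,
        y != x -> J y -> `|(y - x)^-1 * (f y - f x)| < eps.
      exact: (@cvgr0_norm_lt _ _ _ (within J x^') _ _ (fd x Jx) eps eps0).
    have in_st : \forall y \near x, s < y < t.
      have : x \in `]s, t[ by rewrite in_itv.
      by move/near_in_itvoo; apply: filterS => y; rewrite in_itv.
    move: f_lt in_st; rewrite 2!(near_shift 0 x) subr0 => f_lt in_st.
    have {}f_lt := nbhs_dnbhs f_lt; have {}in_st := nbhs_dnbhs in_st.
    near=> h.
    have h0 : h != 0 by near: h; exact: nbhs_dnbhs_neq.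
    have hst : s < h + x < t by near: h.
    have : h + x != x -> J (h + x) ->
        `|(h + x - x)^-1 * (f (h + x) - f x)| < eps by near: h.
    rewrite addrK [h *: 1]mulr1; apply.
      by rewrite -subr_eq0 addrK.
    by case/andP: hst => sh ht; apply: J_st; rewrite !ltW.
  apply: DeriveDef; last exact: cvg_lim slope0.
  by apply/cvg_ex; exists 0.
have f_cont : {within `[s, t], continuous f}.
  apply/continuous_within_itvP => //; split.
  - move=> x; rewrite in_itv /= => /der [fx _].
    exact/differentiable_continuous/derivable1_diffP.
  - apply: cvg_trans (derives_within_cvg (fd s Js)) => P JP.
    have yt := lt_nbhsl st.
    change (nbhs s (fun y => s < y -> P (f y))).
    change (nbhs s (fun y => y != s -> J y -> P (f y))) in JP.
    apply: filterS2 JP yt => y JP yt sy.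
    by apply: JP; [rewrite gt_eqF|apply: J_st; rewrite !ltW].
  - apply: cvg_trans (derives_within_cvg (fd t Jt)) => P JP.
    have sy := lt_nbhsr st.
    change (nbhs t (fun y => y < t -> P (f y))).
    change (nbhs t (fun y => y != t -> J y -> P (f y))) in JP.
    apply: filterS2 JP sy => y JP sy yt.
    by apply: JP; [rewrite lt_eqF|apply: J_st; rewrite !ltW].
have der_itv x : x \in `]s, t[ -> is_derive x 1 f 0.
  by rewrite in_itv; exact: der.
have [c _] := MVT_segment (df := fun=> 0) (ltW st) der_itv f_cont.
by rewrite mul0r => /subr0_eq.
Unshelve. all: by end_near. Qed.

(** * Conservation of the momentum of a cyclic coordinate *)

Lemma partial_cyclic {R : realType} {m : nat} (i : 'I_m) (f : 'rV[R]_m -> R)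
  (y : 'rV[R]_m) :
  (forall c, f (c *: delta_mx 0 i + y) = f y) -> partial i f y = 0.
Proof.
move=> fi; rewrite /partial /derive.
under eq_fun do rewrite /= fi subrr scaler0.
exact: lim_cst.
Qed.

Lemma christoffel_lower {R : realType} {m : nat} (g : 'rV[R]_m -> 'M[R]_m)
  (y : 'rV[R]_m) (k i j : 'I_m) :
  g y \in unitmx ->
  \sum_l g y k l * christoffel g y l i j =
  2^-1 * (partial i (fun z => g z k j) y + partial j (fun z => g z k i) y
          - partial k (fun z => g z i j) y).
Proof.
move=> gU; pose D p := partial i (fun z => g z p j) y
  + partial j (fun z => g z p i) y - partial p (fun z => g z i j) y.
have lowered l : g y k l * christoffel g y l i j =
    2^-1 * \sum_p g y k l * invmx (g y) l p * D p.
  rewrite /christoffel mulrCA mulr_sumr; congr (_ * _).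
  by apply: eq_bigr => p _; rewrite mulrA.
rewrite (eq_bigr _ (fun l _ => lowered l)) -mulr_sumr exchange_big /=.
congr (_ * _).
have inner p : \sum_l g y k l * invmx (g y) l p * D p = (k == p)%:R * D p.
  have /matrixP/(_ k p) := mulmxV gU.
  by rewrite !mxE -mulr_suml => ->.
rewrite (eq_bigr _ (fun p _ => inner p)) (bigD1 k)//= eqxx mul1r big1 ?addr0//.
by move=> p pk; rewrite eq_sym (negbTE pk) mul0r.
Qed.

(** Noether's theorem for a cyclic coordinate x^k.  Lowering the index of the
    geodesic equation gives, with p_k = sum_j g_kj v^j,
      sum_j g_kj a^j
        = - 1/2 sum_ij (d_i g_kj + d_j g_ki - d_k g_ij) v^i v^j
        = - sum_ij d_i g_kj v^i v^j,
    because d_k g_ij = 0 and the first two terms agree after exchanging i and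
    j; by the product and chain rules this says p_k' = 0. *)
Lemma momentum_constant {R : realType} {m : nat} {g : 'rV[R]_m -> 'M[R]_m}
  {U : set 'rV[R]_m} {J : set R} {x v a : R -> 'rV[R]_m} (k : 'I_m) :
  is_interval J -> (forall t, J t -> U (x t)) ->
  derivative_on J x v -> derivative_on J v a ->
  (forall t, J t -> forall l,
     a t 0 l + \sum_i \sum_j christoffel g (x t) l i j * v t 0 i * v t 0 j
     = 0) ->
  (forall y, U y -> g y \in unitmx) ->
  (forall y j, U y -> differentiable (fun z => g z k j) y) ->
  (forall y i j, U y -> partial k (fun z => g z i j) y = 0) ->
  constant_on J (fun t => \sum_j g (x t) k j * v t 0 j).
Proof.
move=> iJ JU xv va geo gU gd gk.
apply: derives_within0_constant => // t Jt.
have Ut := JU t Jt.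
pose dg i j := partial i (fun z => g z k j) (x t).
set S := \sum_i \sum_j dg i j * v t 0 i * v t 0 j.
have S_sym : S = \sum_i \sum_j dg j i * v t 0 i * v t 0 j.
  rewrite /S exchange_big; apply: eq_bigr => i _; apply: eq_bigr => j _.
  by rewrite mulrAC.
have lowered : \sum_l g (x t) k l * a t 0 l = - S.
  have aE l : a t 0 l =
      - \sum_i \sum_j christoffel g (x t) l i j * v t 0 i * v t 0 j.
    by apply/eqP; rewrite -addr_eq0 geo.
  under eq_bigr => l _ do rewrite aE mulrN mulr_sumr.
  rewrite sumrN exchange_big /=; congr (- _).
  have inner i : \sum_l g (x t) k l *
      (\sum_j christoffel g (x t) l i j * v t 0 i * v t 0 j) =
      \sum_j 2^-1 * (dg i j + dg j i) * v t 0 i * v t 0 j.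
    under eq_bigr => l _ do rewrite mulr_sumr.
    rewrite exchange_big /=; apply: eq_bigr => j _.
    transitivity ((\sum_l g (x t) k l * christoffel g (x t) l i j)
      * (v t 0 i * v t 0 j)).
      by rewrite mulr_suml; apply: eq_bigr => l _; rewrite !mulrA.
    rewrite christoffel_lower; last exact: gU.
    by rewrite gk// subr0 !mulrA.
  rewrite (eq_bigr _ (fun i _ => inner i)).
  have -> : S = 2^-1 * (S + S) by field.
  rewrite {2}S_sym -big_split mulr_sumr; apply: eq_bigr => i _.
  rewrite -big_split mulr_sumr; apply: eq_bigr => j _ /=; ring.
have dE : \sum_j ((\sum_i dg i j * v t 0 i) * v t 0 j
                  + g (x t) k j * a t 0 j) = 0.
  rewrite big_split lowered /= -[RHS](subrr S); congr (_ - _).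
  rewrite /S exchange_big; apply: eq_bigr => j _.
  by rewrite mulr_suml.
rewrite -[X in derives_within _ _ _ X]dE.
apply: (derives_within_sum (f := fun j s => g (x s) k j * v s 0 j)) => j.
apply: (derives_withinM (f := fun s => g (x s) k j)).
  exact: (derives_within_comp xv Jt (gd _ j Ut)).
exact: derives_within_coord.
Qed.

(** * The Taub-NUT metric *)

(** Here w is the covector dtau + 2 n cos theta dphi. *)
Lemma taub_nut_metricE {R : realType} (n : R) (y : 'rV[R]_4) (i j : 'I_4) :
  let r := y 0 i_r in let theta := y 0 i_theta in
  let w (k : 'I_4) :=
    (k == i_tau)%:R + 2 * n * cos theta * (k == i_phi)%:R in
  taub_nut_metric n y i j =
  (r - n) / (r + n) * (w i * w j)
  + (r ^+ 2 - n ^+ 2) *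
    ((i == i_theta)%:R * (j == i_theta)%:R
     + sin theta ^+ 2 * ((i == i_phi)%:R * (j == i_phi)%:R))
  + (r + n) / (r - n) * ((i == i_r)%:R * (j == i_r)%:R).
Proof. by move=> r theta w; rewrite /form_sq /dcoord !mxE !big_ord1 !mxE. Qed.

Lemma taub_nut_lower {R : realType} (n : R) (y u : 'rV[R]_4) (k : 'I_4) :
  let r := y 0 i_r in let theta := y 0 i_theta in
  \sum_j taub_nut_metric n y k j * u 0 j =
  (r - n) / (r + n) *
    ((k == i_tau)%:R + 2 * n * cos theta * (k == i_phi)%:R) *
    (u 0 i_tau + 2 * n * cos theta * u 0 i_phi)
  + (r ^+ 2 - n ^+ 2) *
    ((k == i_theta)%:R * u 0 i_theta
     + sin theta ^+ 2 * ((k == i_phi)%:R * u 0 i_phi))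
  + (r + n) / (r - n) * ((k == i_r)%:R * u 0 i_r).
Proof.
move=> r theta.
have sum4 (F : 'I_4 -> R) : \sum_j F j = F i_tau + F i_r + F i_theta + F i_phi.
  rewrite !big_ord_recl big_ord0 addr0 !addrA.
  by congr (F _ + F _ + F _ + F _); apply: val_inj.
rewrite sum4 !taub_nut_metricE -/r -/theta /=.
ring.
Qed.

(** The metric is diagonal, with nonzero entries on the chart, in the coframe
    dtau + 2 n cos theta dphi, dr, dtheta, dphi.  So a vector u killed by it
    satisfies first u_tau + 2 n cos theta u_phi = 0, u_r = 0 and u_theta = 0,
    then u_phi = 0 from the phi component, and finally u_tau = 0. *)
Lemma taub_nut_unit {R : realType} {n : R} {y : 'rV[R]_4} :
  0 < n -> taub_nut_chart n y -> taub_nut_metric n y \in unitmx.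
Proof.
move=> n0 [nr /andP[th0 thpi]]; rewrite -unitmx_tr -row_free_unit.
apply: inj_row_free => u u0.
have low k : \sum_j taub_nut_metric n y k j * u 0 j = 0.
  have := congr1 (fun M : 'rV_4 => M 0 k) u0.
  rewrite mxE [in RHS]mxE => u0k; rewrite -[RHS]u0k.
  by apply: eq_bigr => j _; rewrite [_^T _ _]mxE mulrC.
have := (low i_tau, low i_r, low i_theta, low i_phi).
rewrite !taub_nut_lower /= ?(mulr0, mul0r, mulr1, addr0, add0r, mul1r).
have rn : y 0 i_r - n != 0 by rewrite subr_eq0 gt_eqF.
have rn' : y 0 i_r + n != 0 by rewrite gt_eqF// addr_gt0// (lt_trans n0).
have rn2 : y 0 i_r ^+ 2 - n ^+ 2 != 0 by rewrite subr_sqr mulf_neq0.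
have s0 : sin (y 0 i_theta) != 0 by rewrite gt_eqF// sin_gt0_pi// th0.
move=> [[[ut ur] uth] uph].
have f0 : (y 0 i_r - n) / (y 0 i_r + n) != 0 by rewrite mulf_neq0 ?invr_eq0.
have f0' : (y 0 i_r + n) / (y 0 i_r - n) != 0 by rewrite mulf_neq0 ?invr_eq0.
have cancel (c z : R) : c != 0 -> c * z = 0 -> z = 0.
  by move=> /negbTE c0 /eqP; rewrite mulf_eq0 c0 => /eqP.
move/(cancel _ _ f0): ut => w0.
move/(cancel _ _ f0'): ur => ur0.
move/(cancel _ _ rn2): uth => uth0.
move: uph; rewrite w0 mulr0 add0r => /(cancel _ _ rn2).
move/(cancel _ _ (expf_neq0 2 s0)) => uph0.
move: w0; rewrite uph0 mulr0 addr0 => ut0.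
apply/rowP => j; rewrite [RHS]mxE.
case: j => [[|[|[|[|//]]]] lej].
- by rewrite -ut0; congr (u _ _); exact: val_inj.
- by rewrite -ur0; congr (u _ _); exact: val_inj.
- by rewrite -uth0; congr (u _ _); exact: val_inj.
- by rewrite -uph0; congr (u _ _); exact: val_inj.
Qed.

Lemma taub_nut_differentiable {R : realType} {n : R} {y : 'rV[R]_4}
  (i j : 'I_4) : 0 < n -> taub_nut_chart n y ->
  differentiable (fun z => taub_nut_metric n z i j) y.
Proof.
move=> n0 [nr _].
under eq_fun do rewrite taub_nut_metricE.
have dD (f g : 'rV[R]_4 -> R) : differentiable f y -> differentiable g y ->
  differentiable (fun z => f z + g z) y by exact: differentiableD.
have dM (f g : 'rV[R]_4 -> R) : differentiable f y -> differentiable g y ->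
  differentiable (fun z => f z * g z) y by exact: differentiableM.
have dr : differentiable (fun z : 'rV[R]_4 => z 0 i_r) y.
  exact: differentiable_coord.
have dth : differentiable (fun z : 'rV[R]_4 => z 0 i_theta) y.
  exact: differentiable_coord.
have dcos : differentiable (fun z : 'rV[R]_4 => cos (z 0 i_theta)) y.
  by apply: (differentiable_comp dth); apply/derivable1_diffP.
have dsin : differentiable (fun z : 'rV[R]_4 => sin (z 0 i_theta)) y.
  by apply: (differentiable_comp dth); apply/derivable1_diffP.
have dcst c : differentiable (fun _ : 'rV[R]_4 => c) y.
  exact: differentiable_cst.
have dV (f : 'rV[R]_4 -> R) : differentiable f y -> f y != 0 ->
  differentiable (fun z => (f z)^-1) y by exact: differentiableV.
have dX (f : 'rV[R]_4 -> R) : differentiable f y ->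
  differentiable (fun z => f z ^+ 2) y by move=> df; exact: dM.
have rn : y 0 i_r - n != 0 by rewrite subr_eq0 gt_eqF.
have rn' : y 0 i_r + n != 0 by rewrite gt_eqF// addr_gt0// (lt_trans n0).
by do ![exact: dr | exact: dcos | exact: dsin | exact: dcst | exact: rn
  | exact: rn' | apply: (dV) | apply: (dX) | apply: (dM) | apply: (dD)].
Qed.

Lemma taub_nut_cyclic {R : realType} (n : R) (y : 'rV[R]_4) (k i j : 'I_4) :
  k != i_r -> k != i_theta ->
  partial k (fun z => taub_nut_metric n z i j) y = 0.
Proof.
move=> kr kth; apply: partial_cyclic => c; rewrite !taub_nut_metricE !mxE.
by rewrite ![_ == k]eq_sym (negbTE kr) (negbTE kth) !mulr0 !add0r.
Qed.

(** * Geodesics along which phi is constant *)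

Theorem mainTheorem7 (R : realType) (n : R) (hn : 0 < n)
  (J : set R) (hJ : is_interval J) (x : R -> 'rV[R]_4)
  (hx : geodesic_on (taub_nut_metric n) (taub_nut_chart n) J x)
  (hphi : constant_on J (fun t => x t 0 i_phi)) :
  constant_on J (fun t => x t 0 i_tau) \/ constant_on J (fun t => x t 0 i_theta).
Proof.
(* On an empty or one-point J everything is constant; otherwise derivatives
   within J are unique. *)
have [[a [b [Ja Jb ab]]]|single] :=
    pselect (exists a b, [/\ J a, J b & a != b]); last first.
  left=> s t Js Jt; case: (eqVneq s t) => [->//|st].
  by case: single; exists s, t.
case: hx => JU [v [acc [xv va geo]]].
have conserved (k : 'I_4) : k != i_r -> k != i_theta ->
    constant_on J (fun t => \sum_j taub_nut_metric n (x t) k j * v t 0 j).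
  move=> kr kth; apply: (momentum_constant _ hJ JU xv va geo).
  - by move=> y; exact: taub_nut_unit.
  - by move=> y j; exact: taub_nut_differentiable.
  - by move=> y i j _; exact: taub_nut_cyclic.
have vphi t : J t -> v t 0 i_phi = 0.
  move=> Jt.
  have [c Jc ct] : exists2 c, J c & c != t.
    by case: (eqVneq a t) => [<-|at_]; [exists b; rewrite // eq_sym|exists a].
  have Jproper := dnbhs_within_proper hJ Jt Jc ct.
  have dphi := derives_within_coord i_phi xv Jt.
  have J_near : \forall s \near within J t^', J s by exact: withinT.
  have slope0 : (s - t)^-1 * (x s 0 i_phi - x t 0 i_phi) @[s --> within J t^']
      --> 0.
    apply: cvg_near_cst; near=> s.
    have Js : J s by near: s.
    by rewrite (hphi s t) // subrr mulr0.
  exact: cvg_unique dphi slope0.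
(* With phi' = 0, E is p_tau, and p_phi is 2 n E cos theta. *)
pose E t := (x t 0 i_r - n) / (x t 0 i_r + n) * v t 0 i_tau.
have E_cst : constant_on J E.
  move=> s t Js Jt; have := conserved i_tau isT isT s t Js Jt.
  by rewrite !taub_nut_lower /= !vphi// !(mulr0, mul0r, mulr1, addr0, add0r).
have Ecos_cst : constant_on J (fun t => 2 * n * (E t * cos (x t 0 i_theta))).
  move=> s t Js Jt; have := conserved i_phi isT isT s t Js Jt.
  rewrite !taub_nut_lower /= !vphi// !(mulr0, mul0r, mulr1, addr0, add0r).
  have EcosE u : 2 * n * (E u * cos (x u 0 i_theta)) =
      (x u 0 i_r - n) / (x u 0 i_r + n) * (2 * n * cos (x u 0 i_theta))
      * v u 0 i_tau by rewrite /E; ring.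
  by rewrite !EcosE.
have [Ea0|Ea0] := eqVneq (E a) 0; [left|right].
  apply: derives_within0_constant => // t Jt.
  have [nr _] := JU t Jt.
  suff <- : v t 0 i_tau = 0 by exact: derives_within_coord.
  have := E_cst t a Jt Ja; rewrite Ea0 => /eqP.
  rewrite mulf_eq0 => /orP[|/eqP//].
  rewrite mulf_eq0 invr_eq0 => /orP[] /eqP; lra.
move=> s t Js Jt.
have [_ /andP[s0 spi]] := JU s Js; have [_ /andP[t0 tpi]] := JU t Jt.
apply: cos_inj; rewrite ?in_itv/= ?ltW//.
have := Ecos_cst s t Js Jt.
rewrite (E_cst s a)// (E_cst t a)//.
have n2 : 2 * n != 0 by rewrite mulf_neq0// gt_eqF.
by move=> /(mulfI n2)/(mulfI Ea0).
Unshelve. all: by end_near. Qed.
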